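(* Let $w=e^{2\pi \mathrm i/8}$. For $t,\alpha,\eta,\delta,\beta\in\mathbb C$ with $\alpha^2=-1$, $\eta^2=1$, $\delta^2=1$, $\beta^2=-1$, set $$I_{\alpha,\eta}(t)=[1,\alpha t,\eta,t,-1,\alpha t,-\eta,t],\qquad II_{\delta,\beta}(t)=[1,\delta t,\beta,-t,1,-\delta t,\beta,t].$$ For every $t\in\mathbb C$, each of the vectors $I_{\alpha,\eta}(t)$ and each of the vectors $II_{\delta,\beta}(t)$ satisfies the cyclic coefficient Yang--Baxter equation. Their normalized tower elements decompose as $$\frac{r(I_{\alpha,\eta}(t))}{\sqrt8}=\frac1{\sqrt2}(1+\eta U^2)e_-+t\cdot\frac1{\sqrt2}U(\alpha+U^2)e_+,$$ $$\frac{r(II_{\delta,\beta}(t))}{\sqrt8}=\frac1{\sqrt2}(1+\beta U^2)e_++t\cdot\frac1{\sqrt2}U(\delta-U^2)e_-.$$ In the Pauli realization, the corresponding normalized operators $R(I_{\alpha,\eta}(t))/\sqrt8$ and $R(II_{\delta,\beta}(t))/\sqrt8$ are unitary exactly when $|t|=1$.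
   Context: Let $\mathcal T_3$ be the complex unital algebra generated by $U_1,U_2$ with relations $U_1^8=U_2^8=1$ and $U_1U_2=wU_2U_1$ (it has basis $U_1^jU_2^k$, $0\le j,k\le7$), and let $\mathcal T_2\subset\mathcal T_3$ be the subalgebra generated by $U=U_1$, so $\mathcal T_2\cong\mathbb C[U]/(U^8-1)$. For $\mathbf a=[a_0,\dots,a_7]\in\mathbb C^8$ put $r(\mathbf a)=\sum_{k=0}^7a_kU^k\in\mathcal T_2$ and $r_i(\mathbf a)=\sum_{k=0}^7a_kU_i^k$ ($i=1,2$). The vector $\mathbf a$ satisfies the cyclic coefficient Yang--Baxter equation if $r_1(\mathbf a)r_2(\mathbf a)r_1(\mathbf a)=r_2(\mathbf a)r_1(\mathbf a)r_2(\mathbf a)$ in $\mathcal T_3$; (indices mod 8) this is the identity $a_t\sum_{c}a_{s-c}a_cw^{-ct}=a_s\sum_{c}a_ca_{t-c}w^{-sc}$ for all $s,t\in\mathbb Z/8\mathbb Z$. Put $e_\pm=\frac{1\pm U^4}{2}\in\mathcal T_2$. The Pauli realization: on $\mathbb C^8$ with orthonormal basis $e_j$, $j\in\mathbb Z/8\mathbb Z$, let $Xe_j=e_{j+1}$, $Ze_j=w^je_j$; $R(\mathbf a)=\sum_{k=0}^7a_k(X\otimes Z)^k\in\mathrm{End}(\mathbb C^8\otimes\mathbb C^8)$ is the image of $r(\mathbf a)$ under $U\mapsto X\otimes Z$. *)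

(* Defs.v *)
From HB Require Import structures.
From mathcomp Require Import all_boot all_order all_algebra.
From mathcomp Require Import spectral ring.
From mathcomp Require Import complex mxtens.
From mathcomp Require Import reals topology normedtype trigo.

Set Implicit Arguments.
Unset Strict Implicit.
Unset Printing Implicit Defensive.

Import Order.TTheory GRing.Theory Num.Theory.
Local Open Scope ring_scope.
Local Open Scope complex_scope.

Definition omega (R : realType) : R[i] :=
  cos (2 * pi / 8) +i* sin (2 * pi / 8).

Definition torus_rel (K : fieldType) (w : K) (A : algType K) (U1 U2 : A) :=
  [/\ U1 ^+ 8 = 1, U2 ^+ 8 = 1 & U1 * U2 = w *: (U2 * U1)].

(* A is the unital K-algebra generated by U1 and U2 subject to torus_rel,
   expressed by the universal property of the presentation. *)
Definition torus_presentation (K : fieldType) (w : K) (A : algType K)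
    (U1 U2 : A) :=
  torus_rel w U1 U2 /\
  forall (B : algType K) (V1 V2 : B), torus_rel w V1 V2 ->
    exists f : {lrmorphism A -> B},
      [/\ f U1 = V1, f U2 = V2 &
          forall g : {lrmorphism A -> B}, g U1 = V1 -> g U2 = V2 -> g =1 f].

(* lSemiAlgType, rather than algType, because 'M_n is an algType only when n
   is a syntactic successor. *)
Definition cyc (K : fieldType) (A : lSemiAlgType K) (a : 'rV[K]_8) (x : A) : A :=
  \sum_(k < 8) a 0 k *: x ^+ k.

Definition cyclic_YBE (K : fieldType) (A : algType K) (U1 U2 : A)
    (a : 'rV[K]_8) :=
  cyc a U1 * cyc a U2 * cyc a U1 = cyc a U2 * cyc a U1 * cyc a U2.

Definition vecI (K : fieldType) (alpha eta t : K) : 'rV[K]_8 :=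
  \row_k [:: 1; alpha * t; eta; t; -1; alpha * t; - eta; t]`_k.

Definition vecII (K : fieldType) (delta beta t : K) : 'rV[K]_8 :=
  \row_k [:: 1; delta * t; beta; - t; 1; - (delta * t); beta; t]`_k.

Definition e_plus (K : fieldType) (A : algType K) (U : A) : A :=
  2^-1 *: (1 + U ^+ 4).

Definition e_minus (K : fieldType) (A : algType K) (U : A) : A :=
  2^-1 *: (1 - U ^+ 4).

(* Matrices act on column vectors: column j holds the image of e_j.  The
   addition j + 1 is the one of 'Z_8. *)
Definition pauliX (K : fieldType) : 'M[K]_8 :=
  \matrix_(i, j) ((i : 'Z_8) == (j : 'Z_8) + 1)%:R.

Definition pauliZ (K : fieldType) (w : K) : 'M[K]_8 :=
  \matrix_(i, j) (w ^+ j *+ (i == j)).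

Definition pauliR (K : fieldType) (w : K) (a : 'rV[K]_8) : 'M[K]_(8 * 8) :=
  cyc a (pauliX K *t pauliZ w).

(* The presented algebra exists: it is the space with basis U1^j U2^k
   (j, k in 'Z_8) and the product forced by U2 U1 = w^-1 U1 U2. *)
Section TorusModel.
Variables (K : fieldType) (w : K).
Hypothesis w8 : w ^+ 8 = 1.

Local Notation I := ('Z_8 * 'Z_8)%type.

Definition torus (_ : w ^+ 8 = 1) : Type := {ffun I -> K^o}.
Local Notation T := (torus w8).
HB.instance Definition _ := GRing.Lmodule.copy T {ffun I -> K^o}.

Let s (p q : I) : K := w^-1 ^+ (p.2 * q.1).

Let wV8 : w^-1 ^+ 8 = 1. Proof. by rewrite exprVn w8 invr1. Qed.

Let sDl p q r : s (p + q) r = s p r * s q r.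
Proof.
rewrite /s -exprD -mulnDl -[LHS](expr_mod _ wV8) -[RHS](expr_mod _ wV8).
by congr (_ ^+ _); rewrite /= modnMml.
Qed.

Let sDr p q r : s p (q + r) = s p q * s p r.
Proof.
rewrite /s -exprD -mulnDr -[LHS](expr_mod _ wV8) -[RHS](expr_mod _ wV8).
by congr (_ ^+ _); rewrite /= modnMmr.
Qed.

Let s0l p : s 0 p = 1. Proof. by rewrite /s mul0n. Qed.
Let s0r p : s p 0 = 1. Proof. by rewrite /s muln0. Qed.

Let ev (f : T) (p : I) : K := f p.
Let dl (p : I) : T := [ffun q => (q == p)%:R].
Let mul (f g : T) : T :=
  [ffun p : I => \sum_(q : I) ev f q * ev g (p - q) * s q (p - q)].

Let evD f g p : ev (f + g) p = ev f p + ev g p. Proof. by rewrite /ev ffunE. Qed.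
Let evZ a f p : ev (a *: f) p = a * ev f p. Proof. by rewrite /ev ffunE. Qed.
Let evM f g (p : I) :
  ev (mul f g) p = \sum_(q : I) ev f q * ev g (p - q) * s q (p - q).
Proof. by rewrite /ev ffunE. Qed.
Let evd p q : ev (dl p) q = (q == p)%:R. Proof. by rewrite /ev ffunE. Qed.
Let evP f g : (forall p, ev f p = ev g p) -> f = g.
Proof. by move=> h; apply/ffunP. Qed.

Let mulA : associative mul.
Proof.
move=> f g h; apply: evP => p; rewrite !evM.
under eq_bigr do rewrite evM !mulr_sumr mulr_suml.
under [RHS]eq_bigr do rewrite evM !mulr_suml.
rewrite [RHS]exchange_big /=; apply: eq_bigr => q _.
rewrite [RHS](reindex_inj (addIr q)) /=; apply: eq_bigr => r _.
rewrite addrK opprD addrA [p - r - q]addrAC sDl.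
have -> : s q (p - q) = s q r * s q (p - q - r).
  by rewrite -sDr [r + _]addrC addrNK.
by ring.
Qed.

Let mul1 : left_id (dl 0) mul.
Proof.
move=> f; apply: evP => p; rewrite evM (bigD1 (0 : I)) //= big1 => [|q /negPf q0].
  by rewrite evd eqxx s0l subr0 mul1r mulr1 addr0.
by rewrite evd q0 !mul0r.
Qed.

Let mulr_1 : right_id (dl 0) mul.
Proof.
move=> f; apply: evP => p; rewrite evM (bigD1 p) //= big1 => [|q qp].
  by rewrite subrr evd eqxx s0r !mulr1 addr0.
by rewrite evd subr_eq0 eq_sym (negPf qp) mulr0 mul0r.
Qed.

Let mulDl : left_distributive mul +%R.
Proof.
move=> f g h; apply: evP => p; rewrite evD !evM -big_split.
by apply: eq_bigr => q _; rewrite evD !mulrDl.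
Qed.

Let mulDr : right_distributive mul +%R.
Proof.
move=> f g h; apply: evP => p; rewrite evD !evM -big_split.
by apply: eq_bigr => q _; rewrite evD mulrDr mulrDl.
Qed.

Let one_neq0 : dl 0 != 0.
Proof.
apply/eqP => /(congr1 (ev^~ 0)); rewrite evd eqxx /ev ffunE.
by move/eqP; rewrite oner_eq0.
Qed.

HB.instance Definition _ :=
  GRing.Zmodule_isNzRing.Build T mulA mul1 mulr_1 mulDl mulDr one_neq0.

Let scaleAl (a : K) (f g : T) : a *: (f * g) = (a *: f) * g.
Proof.
apply: evP => p; rewrite evZ !evM mulr_sumr.
by apply: eq_bigr => q _; rewrite evZ !mulrA.
Qed.

HB.instance Definition _ := GRing.Lmodule_isLalgebra.Build K T scaleAl.

Let scaleAr (a : K) (f g : T) : a *: (f * g) = f * (a *: g).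
Proof.
apply: evP => p; rewrite evZ !evM mulr_sumr.
by apply: eq_bigr => q _; rewrite evZ !mulrA [a * _]mulrC.
Qed.

HB.instance Definition _ := GRing.Lalgebra_isAlgebra.Build K T scaleAr.

Definition torusU1 : T := dl (1, 0).
Definition torusU2 : T := dl (0, 1).

Let dlM p q : dl p * dl q = s p q *: dl (p + q).
Proof.
apply: evP => r; rewrite evZ evM (bigD1 p) //= big1 => [|x /negPf xp].
  rewrite addr0 !evd eqxx mul1r subr_eq [q + p]addrC.
  by case: eqP => [->|_]; rewrite ?mul0r ?mulr0 // addrAC subrr add0r mulrC.
by rewrite evd xp !mul0r.
Qed.

Let dl_basis (f : T) : f = \sum_p ev f p *: dl p.
Proof.
apply/ffunP => q; rewrite sum_ffunE (bigD1 q) //= big1 => [|p pq].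
  by rewrite !ffunE eqxx addr0 -[LHS]mulr1.
by rewrite !ffunE eq_sym (negPf pq) scaler0.
Qed.

Let U1X n : torusU1 ^+ n = dl (n%:R, 0).
Proof.
elim: n => [|n IH]; first by [].
rewrite exprS IH dlM /s /= mul0n scale1r; congr dl.
by congr (_, _); rewrite ?addr0 // -natr1 addrC.
Qed.

Let U2X n : torusU2 ^+ n = dl (0, n%:R).
Proof.
elim: n => [|n IH]; first by [].
rewrite exprS IH dlM /s /= muln0 scale1r; congr dl.
by congr (_, _); rewrite ?addr0 // -natr1 addrC.
Qed.

Let dlE p : dl p = torusU1 ^+ p.1 * torusU2 ^+ p.2.
Proof.
case: p => a b; rewrite U1X U2X dlM /s mul0n scale1r /=; congr dl.
by congr (_, _); rewrite ?addr0 ?add0r natr_Zp.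
Qed.

Let w0 : w != 0.
Proof. by apply/eqP => e; move/eqP: w8; rewrite e expr0n eq_sym oner_eq0. Qed.

Lemma torus_model_rel : torus_rel w torusU1 torusU2.
Proof.
have n8 : 8%:R = 0 :> 'Z_8 by apply/val_inj.
split; rewrite ?U1X ?U2X ?n8 // !dlM /s /= scale1r scalerA expr1 divff //.
by rewrite scale1r addrC.
Qed.

Section Universal.
Variables (B : algType K) (V1 V2 : B).
Hypothesis VP : torus_rel w V1 V2.

Let m (p : I) : B := V1 ^+ p.1 * V2 ^+ p.2.

Let comm1 : V2 * V1 = w^-1 *: (V1 * V2).
Proof. by case: VP => _ _ ->; rewrite scalerA mulVf // scale1r. Qed.

Let comm2 a : V2 * V1 ^+ a = w^-1 ^+ a *: (V1 ^+ a * V2).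
Proof.
elim: a => [|a IH]; first by rewrite mulr1 mul1r scale1r.
rewrite [V1 ^+ _.+1]exprSr mulrA IH -scalerAl -[_ * V2 * V1]mulrA comm1.
by rewrite -scalerAr scalerA mulrA -!exprSr.
Qed.

Let comm3 a b : V2 ^+ b * V1 ^+ a = w^-1 ^+ (b * a) *: (V1 ^+ a * V2 ^+ b).
Proof.
elim: b => [|b IH]; first by rewrite mulr1 mul1r scale1r.
rewrite [V2 ^+ _.+1]exprS -mulrA IH -scalerAr [V2 * (_ * _)]mulrA comm2.
by rewrite -scalerAl scalerA -mulrA -exprD mulSn addnC.
Qed.

Let mM p q : m p * m q = s p q *: m (p + q).
Proof.
case: VP => V18 V28 _; rewrite /m.
have -> : V1 ^+ (p + q).1 = V1 ^+ p.1 * V1 ^+ q.1.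
  by rewrite -exprD -[RHS](expr_mod _ V18).
have -> : V2 ^+ (p + q).2 = V2 ^+ p.2 * V2 ^+ q.2.
  by rewrite -exprD -[RHS](expr_mod _ V28).
rewrite -mulrA [V2 ^+ _ * (_ * _)]mulrA comm3 -scalerAl -scalerAr /s.
by rewrite !mulrA.
Qed.

Definition torus_map (f : T) : B := \sum_p ev f p *: m p.

Let map_linear : linear torus_map.
Proof.
move=> a f g; rewrite /torus_map scaler_sumr -big_split; apply: eq_bigr => p _.
by rewrite evD evZ scalerDl scalerA.
Qed.

HB.instance Definition _ :=
  GRing.isLinear.Build K T B *:%R torus_map map_linear.

Let map_dl p : torus_map (dl p) = m p.
Proof.
rewrite /torus_map (bigD1 p) //= big1 => [|q /negPf qp].
  by rewrite evd eqxx scale1r addr0.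
by rewrite evd qp scale0r.
Qed.

Let map_mon : monoid_morphism torus_map.
Proof.
split=> [|f g]; first by rewrite map_dl /m !expr0 mulr1.
rewrite {1}[f]dl_basis {1}[g]dl_basis mulr_suml linear_sum mulr_suml.
apply: eq_bigr => p _; rewrite !mulr_sumr linear_sum; apply: eq_bigr => q _.
rewrite -!scalerAl -!scalerAr dlM !linearZ /= map_dl mM.
by rewrite [RHS]scalerA [ev g q * _]mulrC -scalerA.
Qed.

HB.instance Definition _ := GRing.isMonoidMorphism.Build T B torus_map map_mon.

Lemma torus_universal : exists f : {lrmorphism T -> B},
  [/\ f torusU1 = V1, f torusU2 = V2 &
      forall g : {lrmorphism T -> B},
        g torusU1 = V1 -> g torusU2 = V2 -> g =1 f].
Proof.
exists torus_map; split=> [||g g1 g2 f].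
- by rewrite /= map_dl /m /= expr1 mulr1.
- by rewrite /= map_dl /m /= expr1 mul1r.
rewrite [f in LHS]dl_basis linear_sum; apply: eq_bigr => p _.
by rewrite linearZ /= dlE rmorphM !rmorphXn /= g1 g2.
Qed.

End Universal.

Lemma torus_modelP : torus_presentation w torusU1 torusU2.
Proof. by split=> [|B V1 V2]; [exact: torus_model_rel | exact: torus_universal]. Qed.

End TorusModel.

Lemma omega8 (R : realType) : omega R ^+ 8 = 1.
Proof.
have dbl (x : R) : (cos x +i* sin x) ^+ 2 = cos (x *+ 2) +i* sin (x *+ 2).
  rewrite expr2 mulr2n cosD sinD; congr (_ +i* _).
  by rewrite addrC mulrC [RHS]addrC mulrC.
rewrite (_ : 8 = 2 * (2 * 2))%N // !exprM /omega !dbl.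
rewrite -!mulrnA -[_ *+ _]mulr_natr divfK ?pnatr_eq0 // mulr_natl.
by rewrite cos2pi sin2pi.
Qed.

Lemma torus_presentation_exists (R : realType) :
  exists (T3 : algType R[i]) (U1 U2 : T3), torus_presentation (omega R) U1 U2.
Proof. by exists (torus (omega8 R)), (torusU1 _), (torusU2 _); exact: torus_modelP. Qed.

(* Main.v *)
Require Import Defs.
From mathcomp Require Import all_boot all_order all_algebra.
From mathcomp Require Import spectral ring.
From mathcomp Require Import complex mxtens.
From mathcomp Require Import reals trigo.

Set Implicit Arguments.
Unset Strict Implicit.
Unset Printing Implicit Defensive.

Import Order.TTheory GRing.Theory Num.Theory.
Local Open Scope ring_scope.

(* Sorting both triple products into the monomials [U1 ^+ s * U2 ^+ t] turns the
   Yang-Baxter equation into [a_t G(s, t) = a_s G(t, s)] with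
   [G = ybe_coef w a]; a square root of [-1] is [+- w ^- 2], so for the two
   families these are polynomial identities modulo [w ^+ 4 = -1].
   For unitarity, [V = X (x) Z] is unitary of order 8, so [R(a) R(a)^*] is the
   combination of the powers of [V] given by the cyclic autocorrelation of [a].
   For both families this is [p = 4 (1 + |t|^2)] at index 0, [+- (p - 8)] at
   index 4, and 0 elsewhere.  Among [V ^+ 0, ..., V ^+ 7] only [V ^+ 0] has
   nonzero diagonal entries, [X] being a cyclic shift, which forces [p = 8]. *)

(** * Normal ordering of the triple products *)

Lemma exprD_Z8 (A : pzSemiRingType) (x : A) (i j : 'Z_8) :
  x ^+ 8 = 1 -> x ^+ (i + j)%R = x ^+ i * x ^+ j.
Proof. by move=> x8; rewrite -exprD -[RHS](expr_mod _ x8). Qed.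

(** Moving [U2 ^+ j] past [U1 ^+ i] takes [j * i] transpositions, each contributing one factor
    [w^-1]. *)
Lemma torus_rel_commX (K : fieldType) (w : K) (A : algType K) (U1 U2 : A)
    (i j : nat) : w != 0 -> torus_rel w U1 U2 ->
  U2 ^+ j * U1 ^+ i = w^-1 ^+ (j * i) *: (U1 ^+ i * U2 ^+ j).
Proof.
move=> w0 [_ _ comm].
have comm1 : U2 * U1 = w^-1 *: (U1 * U2).
  by rewrite comm scalerA mulVf // scale1r.
have commX k : U2 * U1 ^+ k = w^-1 ^+ k *: (U1 ^+ k * U2).
  elim: k => [|k IH]; first by rewrite mulr1 mul1r scale1r.
  rewrite [U1 ^+ _.+1]exprSr mulrA IH -scalerAl -[_ * U2 * U1]mulrA comm1.
  by rewrite -scalerAr scalerA mulrA -!exprSr.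
elim: j => [|j IH]; first by rewrite mulr1 mul1r scale1r.
rewrite [U2 ^+ _.+1]exprS -mulrA IH -scalerAr [U2 * (_ * _)]mulrA commX.
by rewrite -scalerAl scalerA -mulrA -exprD mulSn addnC.
Qed.

Lemma mul_cyc (K : fieldType) (A : algType K) (a : 'rV[K]_8) (x y : A) :
  cyc a x * y = \sum_(k < 8) a 0 k *: (x ^+ k * y).
Proof. by rewrite mulr_suml; apply: eq_bigr => k _; rewrite scalerAl. Qed.

Lemma mulr_cyc (K : fieldType) (A : algType K) (a : 'rV[K]_8) (x y : A) :
  y * cyc a x = \sum_(k < 8) a 0 k *: (y * x ^+ k).
Proof. by rewrite mulr_sumr; apply: eq_bigr => k _; rewrite scalerAr. Qed.

(** A twisted cyclic self-convolution of [a]: [s - c] is taken modulo 8, while the exponent [t * c]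
    is a product of natural numbers, as produced by the reordering of powers. *)
Definition ybe_coef (K : fieldType) (w : K) (a : 'rV[K]_8) (s t : 'Z_8) : K :=
  \sum_(c : 'Z_8) a 0 (s - c) * a 0 c * w^-1 ^+ (t * c).

Section TripleProducts.
Variables (K : fieldType) (w : K) (A : algType K) (U1 U2 : A) (a : 'rV[K]_8).
Hypotheses (w0 : w != 0) (UP : torus_rel w U1 U2).

Lemma cyc_121 :
  cyc a U1 * cyc a U2 * cyc a U1 =
  \sum_(s : 'Z_8) \sum_(t : 'Z_8)
    (a 0 t * ybe_coef w a s t) *: (U1 ^+ s * U2 ^+ t).
Proof.
have [U18 U28 _] := UP.
rewrite [RHS]exchange_big /=.
rewrite -mulrA (mul_cyc a U2) mulr_sumr; apply: eq_bigr => t _.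
rewrite mulr_cyc scaler_sumr mulr_sumr.
under [RHS]eq_bigr do rewrite mulr_sumr scaler_suml.
rewrite [RHS]exchange_big; apply: eq_bigr => c _ /=.
(* Here [b] and [c] are the exponents of the left and right [U1] factors, so [s = b + c]. *)
rewrite [RHS](reindex_inj (addIr (c : 'Z_8))) mul_cyc; apply: eq_bigr => b _.
rewrite addrK exprD_Z8 // (torus_rel_commX _ _ w0 UP) -?scalerAr !scalerA.
rewrite [U1 ^+ b * (_ * _)]mulrA.
by congr (_ *: _); ring.
Qed.

Lemma cyc_212 :
  cyc a U2 * cyc a U1 * cyc a U2 =
  \sum_(s : 'Z_8) \sum_(t : 'Z_8)
    (a 0 s * ybe_coef w a t s) *: (U1 ^+ s * U2 ^+ t).
Proof.
have [U18 U28 _] := UP.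
rewrite (mulr_cyc a U1) mulr_suml; apply: eq_bigr => s _.
rewrite mul_cyc scaler_sumr mulr_suml.
under [RHS]eq_bigr do rewrite mulr_sumr scaler_suml.
rewrite [RHS]exchange_big; apply: eq_bigr => c _ /=.
(* Now [c] belongs to the left [U2] factor, the one that must cross [U1 ^+ s], and [t = c + b]. *)
rewrite [RHS](reindex_inj (addrI (c : 'Z_8))) mulr_cyc; apply: eq_bigr => b _.
rewrite [c + b]addrC addrK addrC exprD_Z8 // (torus_rel_commX _ _ w0 UP).
rewrite -!scalerAl !scalerA -[U1 ^+ s * _ * _]mulrA [(c * s)%N]mulnC.
by congr (_ *: _); ring.
Qed.

Lemma cyclic_YBE_coef :
  (forall s t : 'Z_8, a 0 t * ybe_coef w a s t = a 0 s * ybe_coef w a t s) ->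
  cyclic_YBE U1 U2 a.
Proof.
move=> h; rewrite /cyclic_YBE cyc_121 cyc_212.
by apply: eq_bigr => s _; apply: eq_bigr => t _; rewrite h.
Qed.
End TripleProducts.

(** * Coefficient identities for the two families *)

Lemma expf4N1_neq0 (K : fieldType) (w : K) : w ^+ 4 = -1 -> w != 0.
Proof.
move=> w4; apply/eqP=> e; move/eqP: w4.
by rewrite e expr0n eq_sym oppr_eq0 oner_eq0.
Qed.

Lemma sqrtN1E (K : fieldType) (w x : K) : w ^+ 4 = -1 -> x ^+ 2 = -1 ->
  exists2 u : K, u ^+ 2 = 1 & x = u * w^-1 ^+ 2.
Proof.
(* The square of this witness is [x ^+ 2 * w ^+ 4], a product of two factors -1. *)
move=> w4 x2; exists (x * w ^+ 2).
  by rewrite exprMn x2 -exprM w4 mulrNN mulr1.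
by rewrite exprVn mulfK // expf_neq0 // expf4N1_neq0.
Qed.

Lemma ybe_coef_vecI (K : fieldType) (w alpha eta t : K) (s q : 'Z_8) :
  w ^+ 4 = -1 -> alpha ^+ 2 = -1 -> eta ^+ 2 = 1 ->
  let a := vecI alpha eta t in
  a 0 q * ybe_coef w a s q = a 0 s * ybe_coef w a q s.
Proof.
move=> w4 al et /=.
have v4 : w^-1 ^+ 4 = -1 by rewrite exprVn w4 invrN1.
have [u u2 ->] := sqrtN1E w4 al.
(* Only the inverse of [w] is left in the goal; naming it [v] makes both sides polynomials in [v],
   [u], [eta] and [t]. *)
rewrite /ybe_coef; move: (w^-1) v4 => v v4.
rewrite !big_ord_recl !big_ord0 !mxE.
(* Each of the 64 index pairs gives a polynomial identity modulo the relations for [v ^+ 4],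
   [u ^+ 2] and [eta ^+ 2]. *)
case: q => [[|[|[|[|[|[|[|[|q]]]]]]]] hq] //=;
  case: s => [[|[|[|[|[|[|[|[|s]]]]]]]] hs] //=.
all: by ring: v4 u2 et.
Qed.

Lemma ybe_coef_vecII (K : fieldType) (w delta beta t : K) (s q : 'Z_8) :
  w ^+ 4 = -1 -> delta ^+ 2 = 1 -> beta ^+ 2 = -1 ->
  let a := vecII delta beta t in
  a 0 q * ybe_coef w a s q = a 0 s * ybe_coef w a q s.
Proof.
move=> w4 de be /=.
have v4 : w^-1 ^+ 4 = -1 by rewrite exprVn w4 invrN1.
have [u u2 ->] := sqrtN1E w4 be.
rewrite /ybe_coef; move: (w^-1) v4 => v v4.
rewrite !big_ord_recl !big_ord0 !mxE.
case: q => [[|[|[|[|[|[|[|[|q]]]]]]]] hq] //=;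
  case: s => [[|[|[|[|[|[|[|[|s]]]]]]]] hs] //=.
all: by ring: v4 u2 de.
Qed.

Lemma omega4 (R : realType) : omega R ^+ 4 = -1.
Proof.
have dbl (x : R) : (cos x +i* sin x)%C ^+ 2 = (cos (x *+ 2) +i* sin (x *+ 2))%C.
  rewrite expr2 mulr2n cosD sinD; congr (_ +i* _)%C.
  by rewrite addrC mulrC [RHS]addrC mulrC.
rewrite (_ : 4 = 2 * 2)%N // exprM /omega !dbl -!mulrnA.
rewrite (_ : _ *+ _ = pi).
  by rewrite cospi sinpi; congr (_ +i* _)%C; rewrite oppr0.
by rewrite -[_ *+ _]mulr_natr; field.
Qed.

(** * Decomposition of the tower elements *)

Lemma sqrtC8 (K : numClosedFieldType) : sqrtC 8 = 2 * sqrtC 2 :> K.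
Proof.
rewrite (_ : 8 = 2 ^+ 2 * 2); last by rewrite -natrX -natrM.
by rewrite [LHS]sqrtCM ?qualifE /= ?exprn_ge0 ?ler0n // sqrCK ?ler0n.
Qed.

(** Lets identities about powers of [U] be computed in the commutative ring [{poly K}], where [ring]
    applies, and then evaluated at [U]. *)
Lemma cyc_horner (K : fieldType) (A : algType K) (U : A) (a : 'rV[K]_8) :
  cyc a U = horner_alg U (cyc a 'X).
Proof.
rewrite /cyc linear_sum; apply: eq_bigr => k _.
by rewrite linearZ rmorphXn /= horner_algX mulr_algl.
Qed.

Lemma horner_algE (K : fieldType) (A : algType K) (U : A) :
  {morph horner_alg U : p q / p + q} * {morph horner_alg U : p / - p} *
  {morph horner_alg U : p q / p * q} *
  (forall a, {morph horner_alg U : p / a *: p}) * (horner_alg U 1 = 1) *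
  (forall n, horner_alg U ('X ^+ n) = U ^+ n) * (horner_alg U 'X = U).
Proof.
do !split; try exact: horner_algX.
- exact: rmorphD.
- exact: rmorphN.
- exact: rmorphM.
- by move=> a p; rewrite linearZ /= mulr_algl.
- exact: rmorph1.
- by move=> n; rewrite rmorphXn /= horner_algX.
Qed.

Lemma vecI_decomposition (K : numClosedFieldType) (A : algType K) (U : A)
    (alpha eta t : K) :
  (sqrtC 8)^-1 *: cyc (vecI alpha eta t) U =
    (sqrtC 2)^-1 *: ((1 + eta *: U ^+ 2) * e_minus U) +
    t *: ((sqrtC 2)^-1 *: (U * (alpha%:A + U ^+ 2) * e_plus U)).
Proof.
(* Both sides have degree at most 7 in [U], so they already agree as polynomials, before any
   reduction modulo [U ^+ 8 = 1]. *)
suff /(congr1 (horner_alg U)) :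
  (sqrtC 8)^-1 *: cyc (vecI alpha eta t) 'X =
    (sqrtC 2)^-1 *: ((1 + eta *: 'X ^+ 2) * e_minus 'X) +
    t *: ((sqrtC 2)^-1 *: ('X * (alpha%:A + 'X ^+ 2) * e_plus 'X)) :> {poly K}.
  rewrite /e_minus /e_plus.
  by rewrite !horner_algE -cyc_horner.
(* The factor 2 split off from the root of 8 matches the denominator in [e_minus] and [e_plus]. *)
rewrite sqrtC8 invfM /e_minus /e_plus /cyc !big_ord_recl big_ord0 !mxE /=.
rewrite -!mul_polyC !(polyCM, polyCN, polyC1).
by ring.
Qed.

Lemma vecII_decomposition (K : numClosedFieldType) (A : algType K) (U : A)
    (delta beta t : K) :
  (sqrtC 8)^-1 *: cyc (vecII delta beta t) U =
    (sqrtC 2)^-1 *: ((1 + beta *: U ^+ 2) * e_plus U) +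
    t *: ((sqrtC 2)^-1 *: (U * (delta%:A - U ^+ 2) * e_minus U)).
Proof.
suff /(congr1 (horner_alg U)) :
  (sqrtC 8)^-1 *: cyc (vecII delta beta t) 'X =
    (sqrtC 2)^-1 *: ((1 + beta *: 'X ^+ 2) * e_plus 'X) +
    t *: ((sqrtC 2)^-1 *: ('X * (delta%:A - 'X ^+ 2) * e_minus 'X)) :> {poly K}.
  rewrite /e_plus /e_minus.
  by rewrite !horner_algE -cyc_horner.
rewrite sqrtC8 invfM /e_plus /e_minus /cyc !big_ord_recl big_ord0 !mxE /=.
rewrite -!mul_polyC !(polyCM, polyCN, polyC1).
by ring.
Qed.

(** * Conjugates of roots of unity *)

Lemma norm_root1 (C : numClosedFieldType) (n : nat) (w : C) :
  w ^+ n.+1 = 1 -> w * w^* = 1.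
Proof.
move=> wn; rewrite -normCK; apply/eqP; rewrite pexpr_eq1 ?normr_ge0 //.
by rewrite -(@pexpr_eq1 _ _ n.+1) ?normr_ge0 // -normrX wn normr1.
Qed.

Lemma conj_sqrt1 (C : numClosedFieldType) (x : C) : x ^+ 2 = 1 -> x^* = x.
Proof.
move=> x2; have /eqP := x2; rewrite sqrf_eq1 => /orP[] /eqP ->.
  by rewrite rmorph1.
by rewrite rmorphN rmorph1.
Qed.

Lemma conj_sqrtN1 (C : numClosedFieldType) (x : C) : x ^+ 2 = -1 -> x^* = - x.
Proof.
move=> x2; have x4 : x ^+ 4 = 1 by rewrite (exprM x 2 2) x2 sqrrN expr1n.
have x0 : x != 0.
  by apply: contra_eq_neq x2 => ->; rewrite expr0n eq_sym oppr_eq0 oner_eq0.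
(* After multiplication by [x], both sides equal 1. *)
by apply: (mulfI x0); rewrite (norm_root1 x4) mulrN -expr2 x2 opprK.
Qed.

Local Open Scope sesquilinear_scope.

(** * Combinations of powers of a unitary operator of order 8 *)

Section CyclicOperators.
Variables (C : numClosedFieldType) (n : nat) (V : 'M[C]_n.+1).
Hypotheses (V8 : V ^+ 8 = 1) (V_unitary : V \is unitarymx).

Definition autocorr (a : 'rV[C]_8) : 'rV[C]_8 :=
  \row_m \sum_(l : 'Z_8) a 0 ((m : 'Z_8) + l) * (a 0 l)^*.

Lemma expr_unitarymx k : V ^+ k \is unitarymx.
Proof.
elim: k => [|k IH]; last by rewrite exprS; exact: mul_unitarymx.
by apply/unitarymxP; rewrite expr0 trmx1 map_mx1 mulmx1.
Qed.

Lemma cyc_mul_adj (a : 'rV[C]_8) :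
  cyc a V *m (cyc a V)^t* = cyc (autocorr a) V.
Proof.
rewrite [X in _ *m X^t*]/cyc linear_sum raddf_sum mulmx_sumr /=.
rewrite [RHS]/cyc; under [RHS]eq_bigr do rewrite mxE scaler_suml.
rewrite [RHS]exchange_big; apply: eq_bigr => l _ /=.
rewrite linearZ map_mxZ -scalemxAr /cyc mulmx_suml scaler_sumr /=.
(* Shifting the index of the first factor by [l] lets [V ^+ l] cancel against its adjoint, leaving
   [V ^+ m]. *)
rewrite (reindex_inj (addIr (l : 'Z_8))); apply: eq_bigr => m _ /=.
rewrite exprD_Z8 // -scalemxAl scalerA mulrC; congr (_ *: _).
by rewrite -[_ * _]/(_ *m _) -mulmxA (unitarymxP (expr_unitarymx l)) mulmx1.
Qed.
End CyclicOperators.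

(** * The Pauli operators and the unitarity criterion *)

Section Pauli.
Variables (C : numClosedFieldType) (w : C).
Hypothesis w8 : w ^+ 8 = 1.

Lemma pauliXX n (i j : 'Z_8) : (pauliX C ^+ n) i j = (i == j + n%:R)%:R.
Proof.
elim: n i j => [|n IH] i j; first by rewrite expr0 mxE addr0.
rewrite exprSr mxE (bigD1 (j + 1)) //= big1 => [|k kj].
  by rewrite IH mxE eqxx mulr1 addr0 -addrA -mulrS.
by rewrite !mxE (negPf kj) mulr0.
Qed.

Lemma pauliZX n (i j : 'Z_8) : (pauliZ w ^+ n) i j = w ^+ (j * n) *+ (i == j).
Proof.
elim: n i j => [|n IH] i j; first by rewrite expr0 mxE muln0.
rewrite exprSr mxE (bigD1 j) //= big1 => [|k kj].
  by rewrite IH mxE eqxx addr0 mulrnAl -exprD mulnS addnC.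
by rewrite !mxE (negPf kj) mulr0.
Qed.

Lemma pauliX_unitary : pauliX C \is unitarymx.
Proof.
apply/unitarymxP/matrixP => i j; rewrite !mxE.
rewrite (bigD1 (i - 1 : 'Z_8)) //= big1 => [|k].
  by rewrite !mxE subrK eqxx mul1r addr0 conjC_nat eq_sym.
by rewrite eq_sym subr_eq => ki; rewrite !mxE  (negPf ki) mul0r.
Qed.

Lemma pauliZ_unitary : pauliZ w \is unitarymx.
Proof.
apply/unitarymxP/matrixP => i j; rewrite !mxE (bigD1 i) //= big1 => [|k].
  rewrite !mxE eqxx rmorphMn rmorphXn addr0 mulr1n [j == i]eq_sym mulrnAr /=.
  by rewrite -exprMn (norm_root1 w8) expr1n.
by rewrite eq_sym => ki; rewrite !mxE (negPf ki) mul0r.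
Qed.

Local Notation V := (pauliX C *t pauliZ w).

Lemma pauliVX n : V ^+ n = (pauliX C ^+ n) *t (pauliZ w ^+ n).
Proof.
elim: n => [|n IH].
  apply/matrixP => i j.
  case: (mxtens_indexP i) => i1 i2; case: (mxtens_indexP j) => j1 j2.
  rewrite tensmxE !mxE (can_eq (@mxtens_indexK _ _)) xpair_eqE.
  by rewrite -natrM mulnb.
rewrite exprSr IH.
by rewrite [LHS]tensmx_mul; congr (_ *t _); rewrite exprSr.
Qed.

Lemma pauliV8 : V ^+ 8 = 1.
Proof.
(* Writing 1 as [V ^+ 0] splits the identity matrix into a tensor product too, so the two factors
   can be compared separately. *)
rewrite -[1](expr0 V) !pauliVX; congr (_ *t _); apply/matrixP => i j.
  by rewrite pauliXX mxE (_ : 8%:R = 0) ?addr0 //; apply/val_inj.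
by rewrite pauliZX mxE mulnC exprM w8 expr1n.
Qed.

Lemma pauliV_unitary : V \is unitarymx.
Proof.
apply/unitarymxP; rewrite trmx_tens map_mxT tensmx_mul.
rewrite (unitarymxP pauliX_unitary) (unitarymxP pauliZ_unitary).
by rewrite -[RHS](expr0 V) pauliVX.
Qed.

(** The shift sends the basis vector of index 0 to that of index [n] modulo 8, and the diagonal
    factor acts on index 0 with eigenvalue 1. *)
Lemma pauliV_diag0 n : (V ^+ n) (mxtens_index (0, 0)) (mxtens_index (0, 0)) =
  (n == 0 %[mod 8])%:R.
Proof.
rewrite pauliVX tensmxE pauliXX pauliZX eqxx mul0n expr0 mulr1n mulr1 add0r.
by rewrite eq_sym -val_eqE /= val_Zp_nat.
Qed.

(** The constant [c] absorbs the sign that distinguishes the families: 1 for [vecI] and -1 for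
    [vecII]. The shared factor [p - 8] makes the [V ^+ 4] term vanish as soon as the identity term
    is normalized. *)
Lemma pauliR_unitary (a : 'rV[C]_8) (p c : C) :
  autocorr a =
    p *: delta_mx 0 (0 : 'Z_8) + (c * (p - 8)) *: delta_mx 0 (4 : 'Z_8) ->
  (sqrtC 8)^-1 *: pauliR w a \is unitarymx <-> p = 8.
Proof.
move=> E.
have n8 : 8 != 0 :> C by rewrite pnatr_eq0.
have c8 : (sqrtC 8)^-1 * ((sqrtC 8)^-1)^* = 8^-1 :> C.
  by rewrite -normCK normfV exprVn -normrX sqrtCK normr_nat.
have RE : ((sqrtC 8)^-1 *: pauliR w a) *m ((sqrtC 8)^-1 *: pauliR w a)^t* =
    8^-1 *: (p *: V ^+ 0 + (c * (p - 8)) *: V ^+ 4).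
  rewrite linearZ map_mxZ -scalemxAl -scalemxAr scalerA c8.
  rewrite (cyc_mul_adj pauliV8 pauliV_unitary) E /cyc; congr (_ *: _).
  have delta_sum (x : C) (j : 'Z_8) :
      \sum_(k < 8) (x *: delta_mx 0 j : 'rV_8) 0 k *: V ^+ k = x *: V ^+ j.
    rewrite (bigD1 j) //= big1 => [|k /negPf kj].
      by rewrite !mxE !eqxx mulr1 addr0.
    by rewrite !mxE kj mulr0 scale0r.
  under eq_bigr do rewrite mxE scalerDl.
  by rewrite big_split /= !delta_sum.
split=> [/unitarymxP|p8]; last first.
  apply/unitarymxP; rewrite RE p8 subrr mulr0 scale0r addr0 scalerA mulVf //.
  by rewrite scale1r.
(* At this diagonal entry [V ^+ 4] vanishes, so the equation reduces to [p / 8 = 1]. *)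
rewrite RE => /matrixP/(_ (mxtens_index (0, 0)) (mxtens_index (0, 0))).
have scE (x : C) (A : 'M[C]_(8 * 8)) i j : (x *: A) i j = x * A i j.
  by rewrite mxE.
rewrite scE mxE !scE.
rewrite !pauliV_diag0 mulr1 mulr0 addr0 eqxx.
by move=> /(congr1 ( *%R 8)); rewrite mulVKf // mulr1.
Qed.
End Pauli.

(** * Autocorrelations of the two families and conclusion *)

Lemma autocorr_vecI (C : numClosedFieldType) (alpha eta t : C) :
  alpha ^+ 2 = -1 -> eta ^+ 2 = 1 ->
  let p := 4 * (1 + t * t^*) in
  autocorr (vecI alpha eta t) =
    p *: delta_mx 0 (0 : 'Z_8) + (1 * (p - 8)) *: delta_mx 0 (4 : 'Z_8).
Proof.
move=> al et p; apply/rowP => m.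
rewrite /p !mxE !big_ord_recl big_ord0 !mxE /=.
rewrite !(rmorphM, rmorphN, rmorph1) /= (conj_sqrtN1 al) (conj_sqrt1 et).
(* At index 0 the four even positions give 4 and the four odd ones give 4|t|^2. At index 4 the even
   positions change sign, which gives 4|t|^2 - 4 = p - 8. *)
case: m => [[|[|[|[|[|[|[|[|m]]]]]]]] hm] //=.
all: by ring: al et.
Qed.

Lemma autocorr_vecII (C : numClosedFieldType) (delta beta t : C) :
  delta ^+ 2 = 1 -> beta ^+ 2 = -1 ->
  let p := 4 * (1 + t * t^*) in
  autocorr (vecII delta beta t) =
    p *: delta_mx 0 (0 : 'Z_8) + (-1 * (p - 8)) *: delta_mx 0 (4 : 'Z_8).
Proof.
move=> de be p; apply/rowP => m.
rewrite /p !mxE !big_ord_recl big_ord0 !mxE /=.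
rewrite !(rmorphM, rmorphN, rmorph1) /= (conj_sqrt1 de) (conj_sqrtN1 be).
(* Here the odd positions change sign at index 4, which gives 4 - 4|t|^2 = -(p - 8). *)
case: m => [[|[|[|[|[|[|[|[|m]]]]]]]] hm] //=.
all: by ring: de be.
Qed.

Lemma norm1_sqr (C : numClosedFieldType) (t : C) :
  4 * (1 + t * t^*) = 8 <-> `|t| = 1.
Proof.
have n4 : 4 != 0 :> C by rewrite pnatr_eq0.
rewrite -normCK; split=> [|->]; last by rewrite expr1n; ring.
rewrite (_ : 8 = 4 * (1 + 1)); last by ring.
move=> /(mulfI n4)/addrI/eqP.
by rewrite pexpr_eq1 ?normr_ge0 // => /eqP.
Qed.

Theorem proposition5p2 (R : realType) (T3 : algType R[i]) (U1 U2 : T3)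
    (T3_presented : torus_presentation (omega R) U1 U2)
    (t alpha eta delta beta : R[i])
    (alpha2 : alpha ^+ 2 = -1) (eta2 : eta ^+ 2 = 1)
    (delta2 : delta ^+ 2 = 1) (beta2 : beta ^+ 2 = -1) :
  [/\ cyclic_YBE U1 U2 (vecI alpha eta t) /\
      cyclic_YBE U1 U2 (vecII delta beta t),
      (sqrtC 8)^-1 *: cyc (vecI alpha eta t) U1 =
        (sqrtC 2)^-1 *: ((1 + eta *: U1 ^+ 2) * e_minus U1) +
        t *: ((sqrtC 2)^-1 *: (U1 * (alpha%:A + U1 ^+ 2) * e_plus U1)),
      (sqrtC 8)^-1 *: cyc (vecII delta beta t) U1 =
        (sqrtC 2)^-1 *: ((1 + beta *: U1 ^+ 2) * e_plus U1) +
        t *: ((sqrtC 2)^-1 *: (U1 * (delta%:A - U1 ^+ 2) * e_minus U1)),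
      ((sqrtC 8)^-1 *: pauliR (omega R) (vecI alpha eta t) \is unitarymx) <->
        `|t| = 1 &
      ((sqrtC 8)^-1 *: pauliR (omega R) (vecII delta beta t) \is unitarymx) <->
        `|t| = 1].
Proof.
have w4 := omega4 R; have w8 := omega8 R; have w0 := expf4N1_neq0 w4.
have [UP _] := T3_presented.
split; last 2 first.
- by rewrite (pauliR_unitary w8 (autocorr_vecI t alpha2 eta2)) norm1_sqr.
- by rewrite (pauliR_unitary w8 (autocorr_vecII t delta2 beta2)) norm1_sqr.
- split; apply: (cyclic_YBE_coef w0 UP) => s q.
    exact: ybe_coef_vecI.
  exact: ybe_coef_vecII.
- exact: vecI_decomposition.
- exact: vecII_decomposition.
Qed.
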